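(* Let $\{p',q',r',s'\}$ be any other fundamental system of invariants of $\mathbb{C}[x,y,z]^{D_4}$, let $F'=(p',q',r',s')$, and for $d\in\mathbb{N}$ let $g'_d:V_{F'}\to V_{F'}$ be the Chebyshev-induced morphism on the corresponding orbit variety $V_{F'}\simeq\mathbb{C}^3/D_4$. Let $\varphi|_{V_F}:V_F\to V_{F'}$ be the isomorphism given by the expression of $p',q',r',s'$ as polynomials in $p,q,r,s$ (see context). Then $\varphi|_{V_F}\circ g_d=g'_d\circ\varphi|_{V_F}$, where $g_d:V_F\to V_F$ is the Chebyshev-induced morphism for the fundamental system $F=(p,q,r,s)$.
   Context: $\mathbb{N}=\{1,2,\dots\}$. $D_4\subset GL(3,\mathbb{R})$ is the dihedral group of order 8 generated by $(x,y,z)\mapsto(-y,x,-z)$ and $(x,y,z)\mapsto(x,-y,z)$. A fundamental system of invariants is a minimal system of homogeneous generators of the algebra $\mathbb{C}[x,y,z]^{D_4}$. The reference system is $p=x^2+y^2$, $q=z^2$, $r=z(x^2-y^2)$, $s=(x^2-y^2)^2$. Any other fundamental system has (up to order) the form $p'=a_{11}p+a_{12}q$, $q'=a_{21}p+a_{22}q$ with $(a_{ij})\in GL(2,\mathbb{C})$, $r'=br$ with $b\in\mathbb{C}^*$, and $s'=cs+kp^2+mpq+nq^2$ with $c\in\mathbb{C}^*$, $k,m,n\in\mathbb{C}$. Correspondingly $\varphi:\mathbb{C}^4\to\mathbb{C}^4$ is $\varphi(p,q,r,s)=(a_{11}p+a_{12}q,\ a_{21}p+a_{22}q,\ br,\ cs+kp^2+mpq+nq^2)$.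 For a fundamental system $H=(h_1,\dots,h_4)$ let $I_H\subset\mathbb{C}[y_1,\dots,y_4]$ be the ideal of polynomials $h$ with $h(h_1,\dots,h_4)=0$ in $\mathbb{C}[x,y,z]$, and $V_H=V(I_H)\subset\mathbb{C}^4$; the map $\tilde H=(h_1,\dots,h_4):\mathbb{C}^3\to V_H$ is surjective and induces a bijection $\mathbb{C}^3/D_4\simeq V_H$. In particular $V_F=V(r^2-qs)$, and $\varphi$ restricts to an isomorphism $\varphi|_{V_F}:V_F\to V_{F'}$. The Chebyshev endomorphism $P_{A_3}^d:\mathbb{C}^3\to\mathbb{C}^3$ is defined by $P_{A_3}^d(e_1(t),e_2(t),e_3(t))=(e_1(t^d),e_2(t^d),e_3(t^d))$ for $t=(t_1,t_2,t_3,t_4)\in(\mathbb{C}^* )^4$ with $t_1t_2t_3t_4=1$, where $t^d=(t_1^d,\dots,t_4^d)$ and $e_j$ is the $j$-th elementary symmetric polynomial. With $M_3(x,y,z)=(x+iy,\,z,\,x-iy)$ put $f_d=M_3^{-1}\circ P_{A_3}^d\circ M_3$. The induced morphisms $g_d:V_F\to V_F$ and $g'_d:V_{F'}\to V_{F'}$ are the unique maps with $g_d\circ\tilde F=\tilde F\circ f_d$ and $g'_d\circ\tilde F'=\tilde F'\circ f_d$. *)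

(* Defs.v *)
From HB Require Import structures.
From mathcomp Require Import all_boot all_order all_algebra.
From mathcomp Require Import boolp reals complex.
From mathcomp Require Import mpoly.

Set Implicit Arguments.
Unset Strict Implicit.
Unset Printing Implicit Defensive.

Import Order.TTheory GRing.Theory Num.Theory.
Local Open Scope ring_scope.

(* For a realType R, the type R[i] is the field of complex numbers. *)

Section PolynomialMaps.
Variable K : fieldType.

Definition compose_sys (m n k : nat)
    (Phi : m.-tuple {mpoly K[n]}) (H : n.-tuple {mpoly K[k]}) :
    m.-tuple {mpoly K[k]} :=
  [tuple tnth Phi i \mPo H | i < m].

Definition eval_sys (k n : nat) (H : k.-tuple {mpoly K[n]}) (v : 'cV[K]_n) :
    'cV[K]_k :=
  \col_i (tnth H i).@[fun j => v j 0].

Definition relation_ideal (k n : nat) (H : k.-tuple {mpoly K[n]})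
    (h : {mpoly K[k]}) : Prop :=
  h \mPo H = 0.

Definition zero_locus (k : nat) (I : {mpoly K[k]} -> Prop) (v : 'cV[K]_k) :
    Prop :=
  forall h, I h -> h.@[fun j => v j 0] = 0.

Definition variety (k n : nat) (H : k.-tuple {mpoly K[n]}) : Type :=
  {v : 'cV[K]_k | zero_locus (relation_ideal H) v}.

Lemma eval_sys_relation (k n : nat) (H : k.-tuple {mpoly K[n]})
    (v : 'cV[K]_n) (h : {mpoly K[k]}) :
  h.@[fun j => eval_sys H v j 0] = (h \mPo H).@[fun j => v j 0].
Proof.
by rewrite comp_mpoly_meval; apply: meval_eq => i; rewrite mxE.
Qed.

Lemma eval_sys_variety (k n : nat) (H : k.-tuple {mpoly K[n]})
    (v : 'cV[K]_n) :
  zero_locus (relation_ideal H) (eval_sys H v).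
Proof. by move=> h hH; rewrite eval_sys_relation hH meval0. Qed.

Definition tilde (k n : nat) (H : k.-tuple {mpoly K[n]}) (v : 'cV[K]_n) :
    variety H :=
  exist _ (eval_sys H v) (@eval_sys_variety k n H v).

Lemma comp_compose_sys (l k n : nat) (Phi : l.-tuple {mpoly K[k]})
    (H : k.-tuple {mpoly K[n]}) (h : {mpoly K[l]}) :
  h \mPo compose_sys Phi H = (h \mPo Phi) \mPo H.
Proof.
elim/mpolyind: h => [|c m p _ _ IH]; first by rewrite !comp_mpoly0.
rewrite !comp_mpolyD IH; congr (_ + _).
rewrite !comp_mpolyZ !comp_mpolyX rmorph_prod /=; congr (_ *: _).
by apply: eq_bigr => i _; rewrite rmorphXn /= tnth_mktuple.
Qed.

Section Restriction.
Variables (k l n : nat).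
Variables (H : k.-tuple {mpoly K[n]}) (H' : l.-tuple {mpoly K[n]}).
Variables (Phi : l.-tuple {mpoly K[k]}) (HPhi : H' = compose_sys Phi H).

Lemma eval_sys_restrict (v : 'cV[K]_k) :
  zero_locus (relation_ideal H) v ->
  zero_locus (relation_ideal H') (eval_sys Phi v).
Proof.
move=> Hv h hH'; rewrite eval_sys_relation; apply: Hv.
by rewrite /relation_ideal -comp_compose_sys -HPhi.
Qed.

Definition restrict_sys (v : variety H) : variety H' :=
  exist _ (eval_sys Phi (sval v)) (eval_sys_restrict (svalP v)).

End Restriction.

Definition induced_by (k n : nat) (H : k.-tuple {mpoly K[n]})
    (f : 'cV[K]_n -> 'cV[K]_n) (g : variety H -> variety H) : Prop :=
  g \o tilde H =1 tilde H \o f.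

End PolynomialMaps.

Section Dihedral.
Variable R : realType.

Definition rot4 : 'M[R]_3 := \matrix_(i < 3, j < 3)
  nth 0 (nth [::] [:: [:: 0; -1; 0]; [:: 1; 0; 0]; [:: 0; 0; -1]] i) j.

Definition refl_y : 'M[R]_3 := \matrix_(i < 3, j < 3)
  nth 0 (nth [::] [:: [:: 1; 0; 0]; [:: 0; -1; 0]; [:: 0; 0; 1]] i) j.

Inductive D4 : 'M[R]_3 -> Prop :=
| D4_rot4 : D4 rot4
| D4_refl_y : D4 refl_y
| D4_one : D4 1%:M
| D4_mul A B : D4 A -> D4 B -> D4 (A *m B)
| D4_inv A : D4 A -> D4 (invmx A).

Definition linear_sub (A : 'M[R]_3) : 3.-tuple {mpoly R[i][3]} :=
  [tuple \sum_(j < 3) (A i j)%:C%C *: 'X_j | i < 3].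

Definition D4_invariant (f : {mpoly R[i][3]}) : Prop :=
  forall A, D4 A -> f \mPo linear_sub A = f.

Definition generates_invariants (s : seq {mpoly R[i][3]}) : Prop :=
  forall f, D4_invariant f <->
    exists Q : {mpoly R[i][size s]}, f = Q \mPo in_tuple s.

Definition fundamental_system (k : nat) (H : k.-tuple {mpoly R[i][3]}) :
    Prop :=
  [/\ forall h, h \in H -> exists e : nat, h \is e.-homog,
      generates_invariants H
    & forall s, subseq s H -> generates_invariants s -> s = H].

Definition Fref : 4.-tuple {mpoly R[i][3]} :=
  let x : {mpoly R[i][3]} := 'X_0 in
  let y : {mpoly R[i][3]} := 'X_1 in
  let z : {mpoly R[i][3]} := 'X_2 in
  [tuple x ^+ 2 + y ^+ 2; z ^+ 2; z * (x ^+ 2 - y ^+ 2);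
         (x ^+ 2 - y ^+ 2) ^+ 2].

Definition phi (a : 'M[R[i]]_2) (b c k m n : R[i]) :
    4.-tuple {mpoly R[i][4]} :=
  let p : {mpoly R[i][4]} := 'X_0 in
  let q : {mpoly R[i][4]} := 'X_1 in
  let r : {mpoly R[i][4]} := 'X_2 in
  let s : {mpoly R[i][4]} := 'X_3 in
  [tuple a 0 0 *: p + a 0 1 *: q; a 1 0 *: p + a 1 1 *: q; b *: r;
         c *: s + k *: p ^+ 2 + m *: (p * q) + n *: q ^+ 2].

(* The coordinates are (e_1, e_2, e_3): the index j starts at 0. *)
Definition elem_sym (t : 'I_4 -> R[i]) : 'cV[R[i]]_3 :=
  \col_(j < 3) (mesym 4 R[i] j.+1).@[t].

(* As t_1 t_2 t_3 t_4 = 1, all t_j are nonzero. By surjectivity of elem_sym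
   on such t, at most one P satisfies this. *)
Definition is_chebyshev_A3 (d : nat) (P : 'cV[R[i]]_3 -> 'cV[R[i]]_3) :
    Prop :=
  forall t : 'I_4 -> R[i], \prod_(j < 4) t j = 1 ->
    P (elem_sym t) = elem_sym (fun j => t j ^+ d).

Definition M3 : 'M[R[i]]_3 := \matrix_(i < 3, j < 3)
  nth 0 (nth [::] [:: [:: 1; 'i%C; 0]; [:: 0; 0; 1]; [:: 1; - 'i%C; 0]] i) j.

Definition conj_M3 (P : 'cV[R[i]]_3 -> 'cV[R[i]]_3) (v : 'cV[R[i]]_3) :
    'cV[R[i]]_3 :=
  invmx M3 *m P (M3 *m v).

End Dihedral.

(* Main.v *)
(* The map [tilde F] onto the orbit variety is surjective, and phi carries it
   to [tilde F'].  Writing a point of V_F as F(v), both composites therefore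
   send it to F'(f_d v). *)
Require Import Defs.
From mathcomp Require Import all_boot all_order all_algebra.
From mathcomp Require Import reals complex.
From mathcomp Require Import mpoly.
From mathcomp Require Import boolp ring.
Import GRing.Theory Num.Theory Num.Def.
Local Open Scope ring_scope.

(** Intertwining is formal once every point of V_F has the form F(v) ([restrict_sys_induced]). That
    surjectivity is the real content: [tilde_Fref_surj] solves F(v) = w by square roots, using the
    relation r^2 = q s ([variety_Fref_eq]). *)

Lemma variety_eq (K : fieldType) (k n : nat) (H : k.-tuple {mpoly K[n]})
    (v w : variety H) : sval v = sval w -> v = w.
Proof. by case: v w => [v Hv] [w Hw] /= vw; apply: eq_exist. Qed.

Lemma restrict_sys_tilde (K : fieldType) (k l n : nat)
    (H : k.-tuple {mpoly K[n]}) (H' : l.-tuple {mpoly K[n]})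
    (Phi : l.-tuple {mpoly K[k]}) (HPhi : H' = compose_sys Phi H)
    (v : 'cV[K]_n) : restrict_sys HPhi (tilde H v) = tilde H' v.
Proof.
apply/variety_eq/colP => i /=.
by rewrite mxE eval_sys_relation mxE HPhi tnth_mktuple.
Qed.

(** Both composites agree after precomposition with [tilde H], which is onto and so can be
    cancelled. *)
Lemma restrict_sys_induced (K : fieldType) (k l n : nat)
    (H : k.-tuple {mpoly K[n]}) (H' : l.-tuple {mpoly K[n]})
    (Phi : l.-tuple {mpoly K[k]}) (HPhi : H' = compose_sys Phi H)
    (f : 'cV[K]_n -> 'cV[K]_n) (g : variety H -> variety H)
    (g' : variety H' -> variety H') :
  (forall w : variety H, exists v, tilde H v = w) ->
  induced_by f g -> induced_by f g' ->
  restrict_sys HPhi \o g =1 g' \o restrict_sys HPhi.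
Proof.
move=> Hsurj gind g'ind w; have [v <-] := Hsurj w.
have /= -> := gind v.
by rewrite !restrict_sys_tilde; have /= -> := g'ind v.
Qed.

Lemma variety_Fref_eq (R : realType) (w : variety (Fref R)) :
  sval w 2 0 ^+ 2 = sval w 1 0 * sval w 3 0.
Proof.
have rel : relation_ideal (Fref R) ('X_2 ^+ 2 - 'X_1 * 'X_3).
  rewrite /relation_ideal rmorphB rmorphXn rmorphM /= !comp_mpolyXU.
  rewrite -!tnth_nth !(tnth_nth 0) /=; ring.
have := svalP w _ rel.
by rewrite rmorphB rmorphXn rmorphM /= !mevalXU => /subr0_eq.
Qed.

(** With u standing for x^2 - y^2, the system splits: first find z and u from q, r, s, then x and y
    from p and u. *)
Lemma tilde_Fref_surj (R : realType) (w : variety (Fref R)) :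
  exists v, tilde (Fref R) v = w.
Proof.
have := variety_Fref_eq R w.
set p := sval w 0 0; set q := sval w 1 0; set r := sval w 2 0.
set s := sval w 3 0 => rqs.
have [z [u [zq zur us]]] : exists z u : R[i],
    [/\ z ^+ 2 = q, z * u = r & u ^+ 2 = s].
  (* If q = 0, then r = 0 and any root of s serves as u. Otherwise u must be r / z, so that its sign
     matches that of z; then u^2 = r^2 / q = s. *)
  have [q0|q0] := eqVneq q 0.
    exists 0, (sqrtC s); split; rewrite ?sqrtCK ?expr0n ?q0 // mul0r.
    by apply/esym/eqP; rewrite -sqrf_eq0 rqs q0 mul0r.
  have z0 : sqrtC q != 0 by rewrite sqrtC_eq0.
  exists (sqrtC q), (r / sqrtC q); split; first exact: sqrtCK.
    by rewrite mulrC divfK.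
  by rewrite expr_div_n sqrtCK rqs mulrC mulKf.
pose x := sqrtC ((p + u) / 2); pose y := sqrtC ((p - u) / 2).
have xE : x ^+ 2 = (p + u) / 2 by exact: sqrtCK.
have yE : y ^+ 2 = (p - u) / 2 by exact: sqrtCK.
have xDy : x ^+ 2 + y ^+ 2 = p by rewrite xE yE; field.
have xBy : x ^+ 2 - y ^+ 2 = u by rewrite xE yE; field.
exists (\col_(i < 3) [:: x; y; z]`_i).
apply/variety_eq/colP => i; rewrite /= mxE (tnth_nth 0).
have mevalXn (v : 'I_3 -> R[i]) (f : {mpoly R[i][3]}) e :
  (f ^+ e).@[v] = f.@[v] ^+ e by exact: rmorphXn.
case: i => [[|[|[|[|//]]]]] ilt /=;
  rewrite !(mevalXn, mevalM, mevalD, mevalN, mevalXU) !mxE /=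
    ?xDy ?xBy ?zq ?zur ?us.
(* The row indices differ only in their bound proofs. *)
all: by congr (sval w _ _); apply: val_inj.
Qed.

Theorem proposition4p30 (R : realType)
    (F' : 4.-tuple {mpoly R[i][3]}) (fundF' : fundamental_system F')
    (a : 'M[R[i]]_2) (b c k m n : R[i])
    (aU : a \in unitmx) (b0 : b != 0) (c0 : c != 0)
    (F'E : F' = compose_sys (phi a b c k m n) (Fref R))
    (d : nat) (d_gt0 : (0 < d)%N)
    (P : 'cV[R[i]]_3 -> 'cV[R[i]]_3) (Pcheb : is_chebyshev_A3 d P)
    (g : variety (Fref R) -> variety (Fref R))
    (gind : induced_by (conj_M3 P) g)
    (g' : variety F' -> variety F')
    (g'ind : induced_by (conj_M3 P) g') :
  restrict_sys F'E \o g =1 g' \o restrict_sys F'E.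
Proof.
exact: restrict_sys_induced (@tilde_Fref_surj R) gind g'ind.
Qed.
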